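(* Let $X$ be a complex, let $\mathcal{P}\subseteq \mathrm{SD}(X)$ be a convergent subdivisional structure, and let $k\ge 0$. Then the natural map $$\operatorname{colim}_{X'\in\mathcal{P}}\mathrm{Conf}_k^\Box(X')\longrightarrow \mathrm{Conf}_k(X)$$ is a homeomorphism and, in particular, a weak homotopy equivalence.
   Context: A complex is a finite CW complex. A subdivision is a cellular map between complexes that is bijective and preserves subcomplexes (the image of a subcomplex is a subcomplex); in particular it is a homeomorphism. For a complex $X$, $\mathrm{SD}(X)$ is the category whose objects are subdivisions $X\to X'$ and whose morphisms are commuting triangles of subdivisions; an object $X\to X'$ is abbreviated $X'$. A subdivisional structure on $X$ is a subcategory $\mathcal{P}\subseteq\mathrm{SD}(X)$ that is non-empty, full, and filtered. It is convergent if there is a metric on $X$ (inducing its topology) such that $\lim_{X'\in\mathcal{P}}\max_{c\subseteq X'}\mathrm{diam}(c)=0$, where $c$ ranges over the cells of $X'$, regarded as subsets of $X$ through the homeomorphism $X\to X'$. $\mathrm{Conf}_k(X)=\{(x_1,\dots,x_k)\in X^k: x_i\neq x_j\text{ if }i\neq j\}$. The configuration complex $\mathrm{Conf}_k^\Box(X)$ is the largest subcomplex of $X^k$ contained in $\mathrm{Conf}_k(X)$: a product of (closed) cells $(c_1,\dots,c_k)$ lies in it if and only if $c_i\cap c_j=\varnothing$ for $i\ne j$. For a subdivision $s:X'\to X''$, the map $s^k$ restricts to a map $\mathrm{Conf}_k^\Box(X')\to\mathrm{Conf}_k^\Box(X'')$; these are the maps of the diagram. The natural map is induced by the inclusions $\mathrm{Conf}^\Box_k(X')\subseteq\mathrm{Conf}_k(X')\cong\mathrm{Conf}_k(X)$.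 *)

(* Defs.v *)
From HB Require Import structures.
From mathcomp Require Import all_boot all_order all_algebra.
From mathcomp Require Import all_classical all_reals all_analysis.
Set Implicit Arguments.
Unset Strict Implicit.
Unset Printing Implicit Defensive.
Import Order.TTheory GRing.Theory Num.Theory.
Import numFieldNormedType.Exports.

Local Open Scope classical_set_scope.
Local Open Scope ring_scope.

(* The norm of 'rV[R]_n in the library is the sup norm, so the Euclidean disk
   is written with a sum of squares. For n = 0 the disk and its interior are
   the one-point space, and the sphere is empty. *)
Definition sqnorm (R : realType) n (v : 'rV[R]_n) : R := \sum_i v 0 i ^+ 2.

Definition disk (R : realType) n : set 'rV[R]_n := [set v | sqnorm v <= 1].
Definition open_disk (R : realType) n : set 'rV[R]_n := [set v | sqnorm v < 1].
Definition sphere (R : realType) n : set 'rV[R]_n := [set v | sqnorm v = 1].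
Arguments disk : clear implicits.
Arguments open_disk : clear implicits.
Arguments sphere : clear implicits.

(* A finite CW complex, presented by characteristic maps. Only the values of
   char_map on the disk matter. As there are finitely many cells and the space
   is Hausdorff, it automatically has the weak topology. *)
Record complex (R : realType) := Complex {
  space :> topologicalType;
  cell : finType;
  dim : cell -> nat;
  char_map : forall c : cell, 'rV[R]_(dim c) -> space;
  complex_hausdorff : hausdorff_space space;
  char_map_continuous :
    forall c, {within disk R (dim c), continuous (@char_map c)};
  char_map_inj : forall c u v, open_disk R (dim c) u -> open_disk R (dim c) v ->
    @char_map c u = @char_map c v -> u = v;
  char_map_open : forall c (U : set 'rV[R]_(dim c)), open U ->
    exists2 V : set space, open V &
      @char_map c @` (open_disk R (dim c) `&` U) =
      @char_map c @` open_disk R (dim c) `&` V;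
  complex_partition :
    forall x : space, exists! c, (@char_map c @` open_disk R (dim c)) x;
  char_map_sphere : forall c u, sphere R (dim c) u ->
    exists2 c', (dim c' < dim c)%N &
      (@char_map c' @` open_disk R (dim c')) (@char_map c u)
}.

Arguments char_map {R X} c v : rename.

Section Complexes.
Context {R : realType}.
Implicit Types X Y Z : complex R.

Definition open_cell X (c : cell X) : set X :=
  char_map c @` open_disk R (dim c).
Definition closed_cell X (c : cell X) : set X :=
  char_map c @` disk R (dim c).

Definition skeleton X (n : nat) : set X :=
  \bigcup_(c in [set c : cell X | (dim c <= n)%N]) open_cell c.
Arguments skeleton : clear implicits.

Definition subcomplex X (A : set X) : Prop :=
  closed A /\ exists S : set (cell X), A = \bigcup_(c in S) open_cell c.

Definition cellular X Y (f : X -> Y) : Prop :=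
  continuous f /\ forall n, f @` skeleton X n `<=` skeleton Y n.

Record subdivision X Y := Subdivision {
  subdiv_fun :> X -> Y;
  subdiv_cellular : cellular subdiv_fun;
  subdiv_bij : bijective subdiv_fun;
  subdiv_subcomplex :
    forall A : set X, subcomplex A -> subcomplex (subdiv_fun @` A)
}.

Record SD X := SDObj {
  sd_target : complex R;
  sd_map : subdivision X sd_target
}.

Record SD_hom X (s t : SD X) := SDHom {
  sd_hom_map : subdivision (sd_target s) (sd_target t);
  sd_hom_comm : forall x, sd_hom_map (sd_map s x) = sd_map t x
}.

(* A full subcategory is given by its class of objects P, so that the morphisms
   between two objects s and t of P are all of SD_hom s t. *)
Definition filtered_subcat X (P : SD X -> Prop) : Prop :=
  (forall s t, P s -> P t ->
    exists u, [/\ P u, inhabited (SD_hom s u) & inhabited (SD_hom t u)]) /\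
  (forall s t (f g : SD_hom s t), P s -> P t ->
    exists u (h : SD_hom t u), P u /\
      forall x, sd_hom_map h (sd_hom_map f x) = sd_hom_map h (sd_hom_map g x)).

Definition subdivisional_structure X (P : SD X -> Prop) : Prop :=
  (exists s, P s) /\ filtered_subcat P.

Definition metric_for (T : topologicalType) (d : T -> T -> R) : Prop :=
  [/\ forall x y, d x y = 0 <-> x = y,
      forall x y, d x y = d y x,
      forall x y z, d x z <= d x y + d y z &
      forall x (A : set T),
        nbhs x A <-> exists2 e : R, 0 < e & [set y | d x y < e] `<=` A].

Definition diameter (T : Type) (d : T -> T -> R) (A : set T) : \bar R :=
  ereal_sup [set (d xy.1 xy.2)%:E | xy in A `*` A].

(* The cells of the target are pulled back to subsets of X. *)
Definition mesh X (d : X -> X -> R) (s : SD X) : \bar R :=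
  \big[maxe/0%E]_(c : cell (sd_target s))
    diameter d (sd_map s @^-1` closed_cell c).

(* The limit is taken along the filtered category: it has to be reached by all
   the objects of P that receive a morphism from some object of P. *)
Definition convergent X (P : SD X -> Prop) : Prop :=
  exists2 d : X -> X -> R, metric_for d &
    forall e : R, 0 < e -> exists2 s, P s &
      forall t, P t -> inhabited (SD_hom s t) -> (mesh d t < e%:E)%E.

Definition power (T : topologicalType) (k : nat) : topologicalType :=
  prod_topology (fun _ : 'I_k => T).

Definition conf_set (T : topologicalType) (k : nat) : set (power T k) :=
  [set x | forall i j, i != j -> x i <> x j].
Arguments conf_set : clear implicits.

Definition Conf (T : topologicalType) (k : nat) : topologicalType :=
  set_type (conf_set T k).

(* The open cells of the complex X^k are the products of open cells of X. *)
Definition product_cell X k (c : 'I_k -> cell X) : set (power X k) :=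
  [set x | forall i, open_cell (c i) (x i)].

Definition power_subcomplex X k (A : set (power X k)) : Prop :=
  closed A /\
  exists S : set ('I_k -> cell X), A = \bigcup_(c in S) product_cell c.

(* The union of all the subcomplexes of X^k contained in Conf_k(X); it is itself
   one of them, by conf_box_subcomplex and conf_box_sub below. *)
Definition conf_box_set X k : set (power X k) :=
  \bigcup_(A in [set A | power_subcomplex A /\ A `<=` conf_set X k]) A.
Arguments conf_box_set : clear implicits.

Definition ConfBox X k : topologicalType := set_type (conf_box_set X k).

Definition power_map (T U : topologicalType) k (f : T -> U) :
  power T k -> power U k := fun x i => f (x i).

Lemma sqnorm_continuous n : continuous (@sqnorm R n).
Proof.
apply: (@continuous_big R _ +%R 0 xpredT _ 'rV[R]_n (index_enum 'I_n)
  (fun i v => v 0 i ^+ 2)) => [|i _ v]; first exact: add_continuous.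
apply: (@continuous_comp _ _ _ (fun v : 'rV[R]_n => v 0 i) (fun x => x ^+ 2)).
  exact: coord_continuous.
exact: exprn_continuous.
Qed.

Lemma disk_compact n : compact (disk R n).
Proof.
apply: bounded_closed_compact; last first.
  apply: (preimage_closed (f := @sqnorm R n) (D := [set x | x <= 1])).
    by move=> v _; exact: sqnorm_continuous.
  exact: closed_le.
exists 1; split=> // M M1 v dv; apply: le_trans (ltW M1).
rewrite /Num.Def.normr /= mx_normrE; apply: bigmax_le => // -[i j] _ /=.
rewrite ord1 -(@ler_pXn2r _ 2) // ?nnegrE // expr1n real_normK ?num_real //.
apply: le_trans dv; rewrite /sqnorm (bigD1 j) //= lerDl.
by apply: sumr_ge0 => ? _; exact: sqr_ge0.
Qed.

Lemma closed_cell_compact X (c : cell X) : compact (closed_cell c).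
Proof.
apply: continuous_compact; last exact: disk_compact.
exact: char_map_continuous.
Qed.

Lemma open_cell_sub X (c : cell X) : open_cell c `<=` closed_cell c.
Proof. by apply: image_subset => v; exact: ltW. Qed.

Lemma cellP X (x : X) : exists c : cell X, open_cell c x.
Proof. by have [c []] := complex_partition x; exists c. Qed.

Lemma cell_inj X (x : X) (c c' : cell X) :
  open_cell c x -> open_cell c' x -> c = c'.
Proof. by have [d [_ h]] := complex_partition x => /h <- /h. Qed.

Lemma complex_compact X : compact [set: X].
Proof.
have -> : [set: X] = \big[setU/set0]_(c <- enum (cell X)) closed_cell c.
  rewrite -bigcup_seq; apply/seteqP; split => // x _.
  have [c cx] := cellP x; exists c; first by rewrite /= mem_enum.
  exact: open_cell_sub.
by apply: bigsetU_compact => c _; exact: closed_cell_compact.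
Qed.

Lemma closed_cell_closed X (c : cell X) : closed (closed_cell c).
Proof.
apply: compact_closed; first exact: complex_hausdorff.
exact: closed_cell_compact.
Qed.

Lemma closed_cell_skeleton X (c : cell X) (x : X) : closed_cell c x ->
  open_cell c x \/ exists2 c', (dim c' < dim c)%N & open_cell c' x.
Proof.
case=> v; rewrite /disk /= le_eqVlt => /orP[/eqP vs <-|vs <-].
  by right; exact: char_map_sphere.
by left; exists v.
Qed.

Lemma closed_cells X (S : set (cell X)) :
  closed (\bigcup_(c in S) closed_cell c).
Proof.
apply: closed_bigcup => [|c _]; first exact: finite_finset.
exact: closed_cell_closed.
Qed.

Lemma closed_map (T U : topologicalType) (f : T -> U) (A : set T) :
  compact [set: T] -> hausdorff_space U -> continuous f ->
  closed A -> closed (f @` A).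
Proof.
move=> cT hU cf cA; apply: compact_closed => //.
apply: continuous_compact; first exact: continuous_subspaceT.
exact: subclosed_compact cA cT _.
Qed.

Lemma power_compact X k : compact [set: power X k].
Proof.
rewrite (_ : setT = [set x : power X k | forall i, [set: X] (x i)]).
  by apply: (@tychonoff _ (fun=> X) (fun=> setT)) => _; exact: complex_compact.
by apply/seteqP; split.
Qed.

Lemma power_hausdorff X k : hausdorff_space (power X k).
Proof. by apply: hausdorff_product => _; exact: complex_hausdorff. Qed.

Lemma power_continuous (S T : topologicalType) k (f : S -> power T k) :
  (forall i, continuous (fun x => f x i)) -> continuous f.
Proof.
move=> cf x; apply/cvg_sup => i.
move=> U [_ /= [[W oW <-]]] Wfx /filterS; apply; apply: (cf i x).
exact: open_nbhs_nbhs.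
Qed.

Lemma coord_power_continuous (T : topologicalType) k (i : 'I_k) :
  continuous (fun x : power T k => x i).
Proof. exact: (@proj_continuous _ (fun=> T) i). Qed.

Lemma power_map_continuous (T U : topologicalType) k (f : T -> U) :
  continuous f -> continuous (@power_map T U k f).
Proof.
move=> cf; apply: power_continuous => i x.
by apply: continuous_comp; [exact: coord_power_continuous | exact: cf].
Qed.

Lemma subdiv_continuous X Y (f : subdivision X Y) : continuous f.
Proof. by have [] := subdiv_cellular f. Qed.

Lemma power_map_closed X Y (f : subdivision X Y) k (A : set (power X k)) :
  closed A -> closed (power_map f @` A).
Proof.
apply: closed_map; first exact: power_compact.
- exact: power_hausdorff.
- by apply: power_map_continuous; exact: subdiv_continuous.
Qed.

Lemma subdiv_inv_proof X Y (f : subdivision X Y) :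
  exists g : Y -> X, cancel f g /\ cancel g f.
Proof. by have [g] := subdiv_bij f; exists g. Qed.

Definition subdiv_inv X Y (f : subdivision X Y) : Y -> X :=
  sval (cid (subdiv_inv_proof f)).

Lemma subdivK X Y (f : subdivision X Y) : cancel f (subdiv_inv f).
Proof. by rewrite /subdiv_inv; case: cid => g []. Qed.

Lemma subdiv_invK X Y (f : subdivision X Y) : cancel (subdiv_inv f) f.
Proof. by rewrite /subdiv_inv; case: cid => g []. Qed.

Lemma subdiv_inv_continuous X Y (f : subdivision X Y) :
  continuous (subdiv_inv f).
Proof.
apply/continuous_closedP => A cA.
have -> : subdiv_inv f @^-1` A = f @` A.
  apply/seteqP; split => [y Ay|_ [x Ax <-]]; last by rewrite /= subdivK.
  by exists (subdiv_inv f y) => //; exact: subdiv_invK.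
apply: closed_map => //; first exact: complex_compact.
- exact: complex_hausdorff.
- exact: subdiv_continuous.
Qed.

Lemma subcomplexP X (A : set X) (c : cell X) (x : X) (y : X) :
  subcomplex A -> open_cell c x -> open_cell c y -> A x -> A y.
Proof.
move=> [_ [S ->]] cx cy [d Sd dx].
by exists d => //; rewrite -(cell_inj cx dx).
Qed.

Lemma subcomplex_level X (n : nat) (S : set (cell X)) :
  (forall c, S c -> dim c = n) ->
  subcomplex (\bigcup_(c in [set c | (dim c < n)%N \/ S c]) open_cell c).
Proof.
move=> Sn; split; last by eexists.
have -> : \bigcup_(c in [set c | (dim c < n)%N \/ S c]) open_cell c =
    \bigcup_(c in [set c | (dim c < n)%N \/ S c]) closed_cell c.
  apply/seteqP; split => x [c Sc cx].
    by exists c => //; exact: open_cell_sub.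
  have [cx'|[c' c'c c'x]] := closed_cell_skeleton cx; first by exists c.
  exists c' => //; left; case: Sc => [|/Sn <- //]; exact: ltn_trans.
exact: closed_cells.
Qed.

Lemma subdiv_cell X Y (f : subdivision X Y) (c : cell X) (d : cell Y) (x : X)
    (y : Y) :
  open_cell c x -> open_cell d (f x) -> open_cell d y ->
  open_cell c (subdiv_inv f y).
Proof.
move=> cx dx dy.
pose A (S : set (cell X)) :=
  \bigcup_(e in [set e | (dim e < dim c)%N \/ S e]) open_cell e.
have scA S : (forall e, S e -> dim e = dim c) -> subcomplex (f @` A S).
  by move=> Sc; apply: subdiv_subcomplex; exact: subcomplex_level.
have fA S z : (f @` A S) z <-> A S (subdiv_inv f z).
  split=> [[w Aw <-]|Az]; first by rewrite subdivK.
  by exists (subdiv_inv f z) => //; exact: subdiv_invK.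
have [e [|ec] ey] : A [set c] (subdiv_inv f y).
- apply/fA; apply: (subcomplexP (scA _ _) dx dy); first by move=> e ->.
  by exists x => //; exists c => //; right.
- move=> ec; have : (f @` A set0) (f x).
    apply: (subcomplexP (scA _ _) dy dx) => //.
    by apply/fA; exists e => //; left.
  move=> /fA; rewrite subdivK => -[e' [e'c|//] e'x].
  by move: e'c; rewrite (cell_inj e'x cx) ltnn.
- by rewrite -ec.
Qed.

Lemma power_subdiv_subcomplex X Y (f : subdivision X Y) k (A : set (power X k)) :
  power_subcomplex A -> power_subcomplex (power_map f @` A).
Proof.
move=> [cA [S AS]]; split; first exact: power_map_closed.
exists [set d | product_cell d `<=` power_map f @` A].
apply/seteqP; split => [y [x Ax <-{y}]|y [d]]; last by apply.
have [c Sc cx] : (\bigcup_(c in S) product_cell c) x by rewrite -AS.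
have /choice[d dP] : forall i, exists d, open_cell d (f (x i)).
  by move=> i; exact: cellP.
exists d => // y dy; exists (power_map (subdiv_inv f) y); last first.
  by apply/funext => i; exact: subdiv_invK.
rewrite AS; exists c => // i.
exact: subdiv_cell (cx i) (dP i) (dy i).
Qed.

Lemma power_map_conf (T U : topologicalType) k (f : T -> U) (x : power T k) :
  injective f -> conf_set T k x -> conf_set U k (power_map f x).
Proof. by move=> fI xc i j ij /fI; exact: xc. Qed.

Lemma subdiv_injective X Y (f : subdivision X Y) : injective f.
Proof. exact: can_inj (subdivK f). Qed.

Lemma subdiv_inv_injective X Y (f : subdivision X Y) :
  injective (subdiv_inv f).
Proof. exact: can_inj (subdiv_invK f). Qed.

Lemma power_map_conf_box X Y (f : subdivision X Y) k (x : power X k) :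
  conf_box_set X k x -> conf_box_set Y k (power_map f x).
Proof.
move=> [A [scA Ac] Ax]; exists (power_map f @` A); last by exists x.
split; first exact: power_subdiv_subcomplex.
by move=> _ [z /Ac zc <-]; apply: power_map_conf zc; exact: subdiv_injective.
Qed.

Lemma conf_box_sub X k : conf_box_set X k `<=` conf_set X k.
Proof. by move=> x [A [_]]; exact. Qed.

Lemma conf_box_subcomplex X k : power_subcomplex (conf_box_set X k).
Proof.
pose PS := [set A : set (power X k) | power_subcomplex A /\ A `<=` conf_set X k].
have /choice[F FP] : forall c : {ffun 'I_k -> cell X}, exists A, PS A /\
    ((exists2 B, PS B & product_cell c `<=` B) -> product_cell c `<=` A).
  move=> c; have [[B PB cB]|nB] := pselect (exists2 B, PS B & product_cell c `<=` B).
    by exists B.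
  exists set0; do 2?split => //.
  by split; [exact: closed0 | exists set0; rewrite bigcup_set0].
have cover x A : PS A -> A x -> exists2 c : {ffun 'I_k -> cell X},
    product_cell c x & product_cell c `<=` A.
  move=> [[_ [S AS]] _] Ax.
  have [c Sc cx] : (\bigcup_(c in S) product_cell c) x by rewrite -AS.
  exists [ffun i => c i] => [i|y cy]; first by rewrite ffunE.
  by rewrite AS; exists c => // i; have := cy i; rewrite ffunE.
split.
  have -> : conf_box_set X k = \bigcup_(c in [set: {ffun 'I_k -> cell X}]) F c.
    apply/seteqP; split => [x [A PA Ax]|x [c _ Fx]]; last first.
      by exists (F c) => //; have [] := FP c.
    have [c cx cA] := cover x A PA Ax.
    by exists c => //; have [_] := FP c; apply => //; exists A.
  apply: closed_bigcup => [|c _]; first exact: finite_finset.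
  by have [[[]]] := FP c.
exists [set c | product_cell c `<=` conf_box_set X k].
apply/seteqP; split => [x [A PA Ax]|x [c]]; last by apply.
have [c cx cA] := cover x A PA Ax.
by exists c => // y /cA Ay; exists A.
Qed.

Lemma conf_box_largest X k (A : set (power X k)) :
  power_subcomplex A -> A `<=` conf_set X k -> A `<=` conf_box_set X k.
Proof. by move=> sA Ac x Ax; exists A. Qed.

(* Closed cells of a CW complex need not be subcomplexes. When they are, a
   product of closed cells lies in the configuration complex if and only if
   these closed cells are pairwise disjoint. *)
Lemma conf_box_closed_cells X k (c : 'I_k -> cell X) :
  (forall i, subcomplex (closed_cell (c i))) ->
  ([set x : power X k | forall i, closed_cell (c i) (x i)]
     `<=` conf_box_set X k <->
   forall i j, i != j -> closed_cell (c i) `&` closed_cell (c j) = set0).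
Proof.
move=> sc; split=> [sub i j ij|dis].
  rewrite -subset0 => y [ci cj].
  have /choice[z zP] : forall l, exists x, closed_cell (c l) x.
    move=> l; exists (char_map (c l) 0); exists 0 => //.
    rewrite /disk /= /sqnorm big1 // => m _.
    by rewrite mxE expr0n.
  pose x : power X k := fun l => if (l == i) || (l == j) then y else z l.
  have /sub/conf_box_sub/(_ i j ij) : forall l, closed_cell (c l) (x l).
    by move=> l; rewrite /x; case: eqP => [->|_] //=; case: eqP => [->|_].
  by rewrite /x !eqxx orbT.
apply: conf_box_largest => [|x cx i j ij xij]; last first.
  have : (closed_cell (c i) `&` closed_cell (c j)) (x i).
    by split; [exact: cx | rewrite xij; exact: cx].
  by rewrite dis.
split.
  have -> : [set x : power X k | forall i, closed_cell (c i) (x i)] =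
      \bigcap_(i in [set: 'I_k]) (fun x : power X k => x i) @^-1` closed_cell (c i).
    by apply/seteqP; split => [x h i _|x h i]; [exact: h | exact: (h i)].
  apply: closed_bigI => i _.
  apply: (preimage_closed (f := fun x : power X k => x i)) => [x _|].
    exact: coord_power_continuous.
  exact: closed_cell_closed.
exists [set d | forall i, open_cell (d i) `<=` closed_cell (c i)].
apply/seteqP; split => [x cx|x [d dc dx] i]; last exact: dc (dx i).
have /choice[d dP] : forall i, exists d, open_cell d (x i) by move=> i; exact: cellP.
by exists d => // i y dy; exact: subcomplexP (sc i) (dP i) dy (cx i).
Qed.

Lemma continuous_val (S T : topologicalType) (A : set S) (h : S -> T) :
  continuous h -> continuous (fun x : set_type A => h (val x)).
Proof.
move=> ch x; apply: (@continuous_comp _ _ _ (val : set_type A -> S)).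
  exact: (@initial_continuous (set_type A) S set_val).
exact: ch.
Qed.

Definition conf_box_map X Y k (f : subdivision X Y) (x : ConfBox X k) :
    ConfBox Y k :=
  exist _ (power_map f (val x))
    (mem_set (power_map_conf_box f (set_mem (valP x)))).

Lemma conf_box_map_continuous X Y k (f : subdivision X Y) :
  continuous (@conf_box_map X Y k f).
Proof.
apply: continuous_comp_initial; apply: continuous_val.
exact: power_map_continuous (@subdiv_continuous _ _ f).
Qed.

Lemma conf_box_leg_proof X k (s : SD X) (x : power (sd_target s) k) :
  conf_box_set (sd_target s) k x ->
  conf_set X k (power_map (subdiv_inv (sd_map s)) x).
Proof.
by move=> /conf_box_sub; apply: power_map_conf; exact: subdiv_inv_injective.
Qed.

Definition conf_box_leg X k (s : SD X) (x : ConfBox (sd_target s) k) : Conf X k :=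
  exist _ (power_map (subdiv_inv (sd_map s)) (val x))
    (mem_set (conf_box_leg_proof (set_mem (valP x)))).

Lemma conf_box_leg_continuous X k (s : SD X) :
  continuous (@conf_box_leg X k s).
Proof.
apply: continuous_comp_initial; apply: continuous_val.
exact: power_map_continuous (@subdiv_inv_continuous _ _ (sd_map s)).
Qed.

Lemma conf_box_leg_comm X k (s t : SD X) (f : SD_hom s t)
    (x : ConfBox (sd_target s) k) :
  conf_box_leg (conf_box_map (sd_hom_map f) x) = conf_box_leg x.
Proof.
apply/val_inj/funext => i; apply: (@subdiv_injective _ _ (sd_map t)).
by rewrite /= /power_map subdiv_invK -(sd_hom_comm f) subdiv_invK.
Qed.

End Complexes.
Arguments skeleton {R} X n.
Arguments conf_box_set {R} X k.

(* Colimits of topological spaces. The objects of SD(X) range over spaces of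
   the type topologicalType, so their disjoint union is too large to be itself
   in topologicalType; colimits are therefore given by their universal property.
   Cocones only depend on the graph underlying the index category. *)

Record diagram := Diagram {
  index : Type;
  index_hom : index -> index -> Type;
  diag_obj : index -> topologicalType;
  diag_map : forall i j, index_hom i j -> diag_obj i -> diag_obj j;
  diag_map_continuous : forall i j (f : index_hom i j), continuous (diag_map f)
}.

Record cocone (D : diagram) (T : topologicalType) := Cocone {
  leg : forall i : index D, diag_obj i -> T;
  leg_continuous : forall i, continuous (@leg i);
  leg_comm : forall (i j : index D) (f : index_hom i j) (x : diag_obj i),
    leg (diag_map f x) = leg x
}.

Definition is_colimit (D : diagram) (C : topologicalType) (c : cocone D C) :=
  forall (T : topologicalType) (c' : cocone D T), exists! h : C -> T,
    continuous h /\ forall (i : index D) (x : diag_obj i), h (leg c x) = leg c' x.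

Definition colim_map (D : diagram) (C : topologicalType) (c : cocone D C)
    (hc : is_colimit c) (T : topologicalType) (c' : cocone D T) : C -> T :=
  sval (cid (hc T c')).

Definition conf_diagram (R : realType) (X : complex R) (P : SD X -> Prop)
    (k : nat) : diagram := {|
  index := {s : SD X | P s};
  index_hom s t := SD_hom (sval s) (sval t);
  diag_obj s := ConfBox (sd_target (sval s)) k;
  diag_map s t f := conf_box_map (sd_hom_map f);
  diag_map_continuous s t f := @conf_box_map_continuous R _ _ k (sd_hom_map f)
|}.

Definition conf_cocone (R : realType) (X : complex R) (P : SD X -> Prop)
    (k : nat) : cocone (conf_diagram P k) (Conf X k) := {|
  leg (s : index (conf_diagram P k)) := @conf_box_leg R X k (sval s);
  leg_continuous s := @conf_box_leg_continuous R X k (sval s);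
  leg_comm s t f := @conf_box_leg_comm R X k (sval s) (sval t) f
|}.

Definition homeomorphism (T U : topologicalType) (f : T -> U) : Prop :=
  continuous f /\
  exists g : U -> T, [/\ continuous g, cancel f g & cancel g f].

(* Bijectivity of the map that F induces from the quotient of A by eA to the
   quotient of B by eB, written on representatives. *)
Definition bijective_on_classes (S T : Type) (A : set S) (eA : S -> S -> Prop)
    (B : set T) (eB : T -> T -> Prop) (F : S -> T) : Prop :=
  (forall a a', A a -> A a' -> eB (F a) (F a') -> eA a a') /\
  (forall b, B b -> exists2 a, A a & eB (F a) b).

Section Homotopy.
Variables (R : realType).
Implicit Types T U : topologicalType.

Definition unit_interval : set R := [set s | 0 <= s <= 1].

Definition path_joined T (x y : T) : Prop :=
  exists g : R -> T,
    [/\ {within unit_interval, continuous g}, g 0 = x & g 1 = y].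

Definition cube n : set 'rV[R]_n := [set t | forall i, 0 <= t 0 i <= 1].
Definition cube_boundary n : set 'rV[R]_n :=
  [set t | cube t /\ exists i, t 0 i = 0 \/ t 0 i = 1].
Arguments cube : clear implicits.
Arguments cube_boundary : clear implicits.

(* Maps (I^n, bd I^n) -> (T, x0) representing the elements of pi_n(T, x0); their
   values outside of the cube are irrelevant. *)
Definition spheroid n T (x0 : T) : set ('rV[R]_n -> T) :=
  [set g | {within cube n, continuous g} /\
           forall t, cube_boundary n t -> g t = x0].
Arguments spheroid : clear implicits.

Definition homotopic_rel n T (x0 : T) (g h : 'rV[R]_n -> T) : Prop :=
  exists H : R * 'rV[R]_n -> T,
    [/\ {within unit_interval `*` cube n, continuous H},
        forall t, cube n t -> H (0, t) = g t,
        forall t, cube n t -> H (1, t) = h t &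
        forall s t, unit_interval s -> cube_boundary n t -> H (s, t) = x0].

(* On homotopy groups the induced map is a morphism, so it is an isomorphism as
   soon as it is bijective. *)
Definition weak_homotopy_equivalence T U (f : T -> U) : Prop :=
  [/\ continuous f,
      bijective_on_classes [set: T] (@path_joined T) [set: U] (@path_joined U) f &
      forall n (x0 : T), (0 < n)%N ->
        bijective_on_classes
          (spheroid n T x0) (@homotopic_rel n T x0)
          (spheroid n U (f x0)) (@homotopic_rel n U (f x0))
          (fun g => f \o g)].

End Homotopy.

(* Main.v *)
Require Import Defs.
From mathcomp Require Import all_boot all_order all_algebra.
From mathcomp Require Import all_classical all_reals all_analysis.
From mathcomp Require Import lra.
(* Imported again so that [dim] is the dimension of a cell. *)
Import Defs.
Set Implicit Arguments.
Unset Strict Implicit.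
Unset Printing Implicit Defensive.
Import Order.TTheory GRing.Theory Num.Theory.
Import numFieldNormedType.Exports.

Local Open Scope classical_set_scope.
Local Open Scope ring_scope.

(** The space Conf_k(X) is itself a colimit of the configuration complexes; the
    theorem follows, since two colimits of a diagram are homeomorphic through
    the comparison map, and a homeomorphism is a weak homotopy equivalence.

    The legs ConfBox_k(X') -> Conf_k(X) are injective, and each is a homeomorphism
    onto its image, because its inverse is induced by the subdivision X -> X'.
    Any two objects of P map to a third one, so the maps of a cocone agree
    wherever two images overlap, and they glue to a map h on the union of the
    images. It remains to see that the images cover Conf_k(X) and that h is
    continuous. Both follow from local surjectivity ([conf_box_leg_local]):
    every configuration x has a neighbourhood contained in the image of a single
    leg.

    For local surjectivity, let r > 0 be a lower bound of the distances between
    the points of x, and take X' of small mesh e. If every z_i is close to x_i,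
    then the points z_i are still far apart compared to e. Let c_i be the open
    cell of X' containing z_i. A closed cell need not be a subcomplex, so c_i is
    replaced by its carrier: the union of the cells reached from c_i by repeatedly
    passing to a cell of smaller dimension that meets the closed cell. The carrier
    is a subcomplex, and all its points are within (dim c_i + 1) e of z_i, as the
    dimension drops at each step ([carrier_distance]). The dimension of X' is at
    most that of X, because a subdivision is a cellular surjection
    ([subdivision_dim]); hence the bound is uniform in X', and for e small
    compared to r / (dim X + 1) the carriers are pairwise disjoint. Their product
    is then a subcomplex of X'^k contained in Conf_k(X'), and it contains z. *)

(** * Carriers of cells *)

Section Carriers.
Context {R : realType}.
Implicit Types X Y : complex R.

(** The cells of the smallest subcomplex containing a given cell: those at the
    end of a chain in which each cell meets the closure of the one before it. *)
Inductive carried X : cell X -> cell X -> Prop :=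
| carried_refl c : carried c c
| carried_step c c1 c' : (dim c1 < dim c)%N ->
    closed_cell c `&` open_cell c1 !=set0 -> carried c1 c' -> carried c c'.

Lemma carried_trans X (c c1 c2 : cell X) :
  carried c c1 -> carried c1 c2 -> carried c c2.
Proof.
by move=> h; elim: h => // {}c c' {}c1 lt ne _ IH /IH; exact: carried_step.
Qed.

Definition carrier X (c : cell X) : set X :=
  \bigcup_(c' in carried c) open_cell c'.

(** The sphere of a cell is mapped into cells of smaller dimension, which continue
    the chain; so passing to closures adds nothing, and the carrier is closed. *)
Lemma carrier_closed_cells X (c : cell X) :
  carrier c = \bigcup_(c' in carried c) closed_cell c'.
Proof.
apply/seteqP; split=> x [c' cc' c'x].
  by exists c' => //; exact: open_cell_sub.
have [c'x'|[c1 lt c1x]] := closed_cell_skeleton c'x; first by exists c'.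
exists c1 => //; apply: (carried_trans cc').
by apply: (carried_step lt); [exists x | exact: carried_refl].
Qed.

Lemma carrier_subcomplex X (c : cell X) : subcomplex (carrier c).
Proof.
by split; [rewrite carrier_closed_cells; exact: closed_cells | exists (carried c)].
Qed.

Lemma open_cell_carrier X (c : cell X) : open_cell c `<=` carrier c.
Proof. by move=> x cx; exists c => //; exact: carried_refl. Qed.

(** Consecutive closed cells of a chain share a point, so each of them costs at
    most [e], and a chain from [c] has at most [(dim c).+1] cells. *)
Lemma carrier_distance X (d : X -> X -> R) (e : R) (c : cell X) (x y : X) :
  (forall x y z, d x z <= d x y + d y z) ->
  (forall c x y, closed_cell c x -> closed_cell c y -> d x y <= e) ->
  closed_cell c x -> carrier c y -> d x y <= (dim c).+1%:R * e.
Proof.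
move=> tri small cx [c' cc' c'y].
have e0 : 0 <= e.
  have := small c x x cx cx; have := tri x x x; lra.
elim: cc' x cx c'y => [{}c x cx cy|{}c c1 {}c' lt [w [cw c1w]] _ IH x cx c'y].
  apply: le_trans (small c x y cx (open_cell_sub cy)) _.
  by rewrite ler_peMl // ler1n.
apply: le_trans (tri x w y) _.
have := IH w (open_cell_sub c1w) c'y.
have := small c x w cx cw.
have : (dim c1).+2%:R * e <= (dim c).+1%:R * e.
  by rewrite ler_wpM2r // ler_nat ltnS.
rewrite -(natr1 (dim c1).+1) mulrDl mul1r; lra.
Qed.

(** The n-skeleton of [X] is all of [X], and a cellular surjection carries it onto
    [Y] inside the n-skeleton of [Y]. *)
Lemma subdivision_dim X Y (f : subdivision X Y) n :
  (forall c : cell X, dim c <= n)%N -> forall c : cell Y, (dim c <= n)%N.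
Proof.
move=> Xn c; pose y := char_map c 0.
have cy : open_cell c y.
  exists 0 => //; rewrite /open_disk /= /sqnorm big1 // => i _.
  by rewrite mxE expr0n.
have [_ /(_ n) sk] := subdiv_cellular f.
have [c' c'n c'y] : skeleton Y n y.
  apply: sk; exists (subdiv_inv f y); last exact: subdiv_invK.
  by have [b bx] := cellP (subdiv_inv f y); exists b => //; exact: Xn.
by rewrite (cell_inj cy c'y).
Qed.

Lemma product_subcomplex X k (A : 'I_k -> set X) :
  (forall i, subcomplex (A i)) ->
  power_subcomplex [set x : power X k | forall i, A i (x i)].
Proof.
move=> sA; split.
  have -> : [set x : power X k | forall i, A i (x i)] =
      \bigcap_(i in [set: 'I_k]) (fun x : power X k => x i) @^-1` A i.
    by apply/seteqP; split => [x h i _|x h i]; [exact: h | exact: (h i)].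
  apply: closed_bigI => i _.
  apply: (preimage_closed (f := fun x : power X k => x i)) => [x _|].
    exact: coord_power_continuous.
  by have [] := sA i.
exists [set c | forall i, open_cell (c i) `<=` A i].
apply/seteqP; split => [x Ax|x [c cA cx] i]; last exact: cA (cx i).
have /choice[c cx] : forall i, exists c, open_cell c (x i) by move=> i; exact: cellP.
by exists c => // i y cy; exact: subcomplexP (sA i) (cx i) cy (Ax i).
Qed.

(** The carriers of the cells containing the points of [y] are pairwise disjoint,
    so that their product is a subcomplex contained in the configuration space. *)
Lemma conf_box_separated X k (d : X -> X -> R) (e : R) n (y : power X k) :
  (forall x y, d x y = d y x) ->
  (forall x y z, d x z <= d x y + d y z) ->
  (forall c x y, closed_cell c x -> closed_cell c y -> d x y <= e) ->
  0 <= e -> (forall c : cell X, dim c <= n)%N ->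
  (forall i j, i != j -> n.+1%:R * e *+ 2 < d (y i) (y j)) ->
  conf_box_set X k y.
Proof.
move=> sym tri small e0 Xn sep.
have /choice[c cy] : forall i, exists c, open_cell c (y i) by move=> i; exact: cellP.
pose A := [set x : power X k | forall i, carrier (c i) (x i)].
have sA : power_subcomplex A.
  by apply: (@product_subcomplex _ _ (fun i => carrier (c i))) => i;
    exact: carrier_subcomplex.
suff Aconf : A `<=` @conf_set X k.
  by apply: (conf_box_largest sA Aconf) => i; exact: open_cell_carrier.
move=> z cz i j ij zij.
have far l : d (y l) (z l) <= n.+1%:R * e.
  apply: le_trans (carrier_distance tri small (open_cell_sub (cy l)) (cz l)) _.
  by rewrite ler_wpM2r // ler_nat ltnS.
have := sep i j ij; have := tri (y i) (z i) (y j); have := far i; have := far j.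
rewrite -zij (sym (z i)); lra.
Qed.

End Carriers.

(** * Local surjectivity of the cocone *)

Section Local.
Context {R : realType} (X : complex R).
Implicit Types (s : SD X) (d : X -> X -> R).

Lemma mesh_bound d s e (c : cell (sd_target s)) x y :
  (mesh d s < e%:E)%E -> closed_cell c x -> closed_cell c y ->
  d (subdiv_inv (sd_map s) x) (subdiv_inv (sd_map s) y) < e.
Proof.
move=> me cx cy; rewrite -lte_fin; apply: le_lt_trans me.
rewrite /mesh.
apply: (@le_trans _ _ (diameter d (sd_map s @^-1` closed_cell c))).
  apply: ereal_sup_ubound.
  exists (subdiv_inv (sd_map s) x, subdiv_inv (sd_map s) y) => //.
  by split; rewrite /= subdiv_invK.
exact: le_bigmax.
Qed.

Lemma conf_separation k d (x : power X k) :
  metric_for d -> conf_set x ->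
  exists2 r : R, 0 < r & forall i j, i != j -> r <= d (x i) (x j).
Proof.
move=> [d0 sym tri _] cx.
have dpos a b : a <> b -> 0 < d a b.
  move=> ab; have := tri a b a; rewrite (sym b a).
  have -> : d a a = 0 by apply/d0.
  have : d a b != 0 by apply/eqP => /d0.
  lra.
(* The default 1 provides a positive number when there is no pair of indices. *)
exists (\big[Num.min/1]_(p : 'I_k * 'I_k | p.1 != p.2) d (x p.1) (x p.2)).
  by apply: lt_bigmin => // -[i j] /= ij; apply: dpos; exact: cx.
by move=> i j ij; exact: (@bigmin_le_cond _ _ _ 1 (i, j)).
Qed.

(** This makes the legs jointly surjective, and it lets the continuity of a map
    out of [Conf X k] be tested on one leg at a time. *)
Lemma conf_box_leg_local (P : SD X -> Prop) k (x : Conf X k) :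
  subdivisional_structure P -> convergent P ->
  exists2 s, P s & \forall z \near x, exists y, @conf_box_leg R X k s y = z.
Proof.
move=> [_ [dir _]] [d md conv].
have [r r0 xr] := conf_separation md (set_mem (valP x)).
have [d0 sym tri dn] := md.
pose n := (\max_(c : cell X) dim c)%N.
have Xn (c : cell X) : (dim c <= n)%N by exact: leq_bigmax.
(* Carriers of radius [n.+1 * e] around two points must not meet: this takes a
   distance above [2 * n.+1 * e]. Each of the two points moves by less than [e],
   and a third [e] makes the inequality strict. *)
pose e := r / (n.+1%:R *+ 2 + 3).
have e0 : 0 < e by rewrite divr_gt0 // ltr_wpDl // mulrn_wge0.
have re : r = n.+1%:R * e *+ 2 + e *+ 3.
  have : e * (n.+1%:R *+ 2 + 3) = r.
    by rewrite divfK // gt_eqF // ltr_wpDl // mulrn_wge0.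
  by lra.
have [s Ps sm] := conv e e0.
(* Convergence speaks of the objects that receive a morphism from [s]. *)
have [u [Pu su _]] := dir s s Ps Ps.
have mu := sm u Pu su.
exists u => //.
have nearx : \forall z \near x, forall i, d (val x i) (val z i) < e.
  apply: (@filter_forall _ _
    (fun i (z : Conf X k) => d (val x i) (val z i) < e) (nbhs x)) => i.
  have ci : continuous (fun z : Conf X k => val z i).
    exact: (continuous_val (@coord_power_continuous X k i)).
  by apply: (ci x [set w | d (val x i) w < e]); apply/dn; exists e.
apply: filterS nearx => z zx.
pose f := sd_map u.
have zbox : conf_box_set (sd_target u) k (power_map f (val z)).
  apply: (@conf_box_separated _ _ _
    (fun a b => d (subdiv_inv f a) (subdiv_inv f b)) e n).
  - by move=> a b; exact: sym.
  - by move=> a b c; exact: tri.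
  - by move=> c a b ca cb; apply: ltW; exact: (mesh_bound mu ca cb).
  - exact: ltW.
  - exact: (subdivision_dim f).
  - move=> i j ij; rewrite /power_map !subdivK.
    have := xr i j ij; have := zx i; have := zx j.
    have := tri (val x i) (val z i) (val x j).
    have := tri (val z i) (val z j) (val x j).
    rewrite (sym (val z j) (val x j)); lra.
pose y : ConfBox (sd_target u) k := exist _ (power_map f (val z)) (mem_set zbox).
exists y.
by apply/val_inj/funext => i /=; exact: subdivK.
Qed.

End Local.

(** * The configuration space as a colimit *)

Section Colimit.
Context {R : realType} (X : complex R).

(** The left inverse of the leg is induced by a map that is continuous on all of
    [Conf X k], so the leg is an embedding. *)
Lemma conf_box_legK k (s : SD X) (y : ConfBox (sd_target s) k) :
  power_map (sd_map s) (val (conf_box_leg y)) = val y.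
Proof. by apply/funext => i; exact: subdiv_invK. Qed.

Lemma conf_box_leg_inj k (s : SD X) : injective (@conf_box_leg R X k s).
Proof. by move=> y z yz; apply: val_inj; rewrite -!conf_box_legK yz. Qed.

Lemma conf_cocone_colimit (P : SD X -> Prop) k :
  subdivisional_structure P -> convergent P -> is_colimit (conf_cocone P k).
Proof.
move=> sP cP T c'.
have local (x : Conf X k) := conf_box_leg_local x sP cP.
have [_ [dir _]] := sP.
(* Two points are compared in a common refinement, whose leg is injective. *)
have agree (i j : index (conf_diagram P k)) (y : diag_obj i) (z : diag_obj j) :
    leg (conf_cocone P k) y = leg (conf_cocone P k) z -> leg c' y = leg c' z.
  case: i j y z => [s Ps] [t Pt] /= y z yz.
  have [u [Pu [f] [g]]] := dir s t Ps Pt.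
  pose D := conf_diagram P k.
  pose i : index D := exist _ s Ps; pose j : index D := exist _ t Pt.
  pose l : index D := exist _ u Pu.
  rewrite -(@leg_comm D T c' i l f y) -(@leg_comm D T c' j l g z).
  congr leg; apply: conf_box_leg_inj; rewrite /=.
  by rewrite !conf_box_leg_comm.
have /choice[h hP] : forall x : Conf X k, exists t : T,
    forall (i : index (conf_diagram P k)) (y : diag_obj i),
      leg (conf_cocone P k) y = x -> t = leg c' y.
  move=> x; have [s Ps /nbhs_singleton[y yx]] := local x.
  exists (@leg _ _ c' (exist _ s Ps) y) => i z zx.
  by apply: agree; rewrite zx.
exists h; split; last first.
  move=> h' [_ h'leg]; apply/funext => x.
  have [s Ps /nbhs_singleton[y yx]] := local x.
  pose i : index (conf_diagram P k) := exist _ s Ps.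
  by rewrite (hP x i y yx) -(h'leg i y) /= yx.
split; last by move=> i y; exact: hP.
(* Near [x], [h] is the leg of [c'] at [s] after the inverse of the leg at [s]. *)
move=> x W; have [s Ps sx] := local x.
have [y yx] := nbhs_singleton sx.
pose i : index (conf_diagram P k) := exist _ s Ps.
rewrite (hP x i y yx) => /(@leg_continuous _ _ c' i y).
rewrite /= => -[_ [[V oV <-]] /= Vy VW].
have : \forall z \near x, V (power_map (sd_map s) (val z)).
  have cs : continuous (fun z : Conf X k => power_map (sd_map s) (val z)).
    have := @power_map_continuous _ _ k _ (@subdiv_continuous _ _ _ (sd_map s)).
    exact: continuous_val.
  apply: (cs x V); apply: open_nbhs_nbhs.
  by split => //; rewrite -yx conf_box_legK.
apply: filter_app; apply: filterS sx => z [y' y'z] Vz /=.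
rewrite (hP z i y' y'z); apply: VW.
have y'E : val y' = power_map (sd_map s) (val z) by rewrite -conf_box_legK y'z.
by move: Vz; rewrite -y'E.
Qed.

End Colimit.

(** * Comparison of colimits and homeomorphisms *)

Lemma colim_mapP (D : diagram) (C : topologicalType) (c : cocone D C)
    (hc : is_colimit c) (T : topologicalType) (c' : cocone D T) :
  continuous (colim_map hc c') /\
  forall (i : index D) (x : diag_obj i), colim_map hc c' (leg c x) = leg c' x.
Proof. by rewrite /colim_map; case: cid => h []. Qed.

Lemma colimit_endo (D : diagram) (C : topologicalType) (c : cocone D C)
    (h : C -> C) : is_colimit c -> continuous h ->
  (forall (i : index D) (x : diag_obj i), h (leg c x) = leg c x) -> h =1 id.
Proof.
move=> /(_ C c)[h0 [_ uniq]] ch hleg.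
by move=> x; rewrite -(uniq h) // (uniq id) //; split=> // y; exact: cvg_id.
Qed.

Lemma colimit_homeomorphism (D : diagram) (C T : topologicalType)
    (c : cocone D C) (c' : cocone D T) (hc : is_colimit c) :
  is_colimit c' -> homeomorphism (colim_map hc c').
Proof.
move=> hc'; have [cf fleg] := colim_mapP hc c'.
have [cg gleg] := colim_mapP hc' c.
split=> //; exists (colim_map hc' c); split=> //.
- apply: (colimit_endo (h := colim_map hc' c \o colim_map hc c') hc) => [x|i x].
    by apply: continuous_comp; [exact: cf | exact: cg].
  by rewrite /= fleg gleg.
- apply: (colimit_endo (h := colim_map hc c' \o colim_map hc' c) hc') => [x|i x].
    by apply: continuous_comp; [exact: cg | exact: cf].
  by rewrite /= gleg fleg.
Qed.

Section HomeomorphismWeakEquivalence.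
Context {R : realType}.

Lemma within_comp (S T U : topologicalType) (A : set S) (g : S -> T) (f : T -> U) :
  {within A, continuous g} -> continuous f -> {within A, continuous (f \o g)}.
Proof. by move=> cg cf; apply: within_continuous_comp cg => y _; exact: cf. Qed.

Lemma path_joined_map (T U : topologicalType) (f : T -> U) (x y : T) :
  continuous f -> path_joined R x y -> path_joined R (f x) (f y).
Proof.
move=> cf [g [cg <- <-]]; exists (f \o g); split=> //; exact: within_comp.
Qed.

Lemma path_joined_refl (T : topologicalType) (x : T) : path_joined R x x.
Proof. by exists (fun=> x); split=> // t; exact: cvg_cst. Qed.

Lemma spheroid_map n (T U : topologicalType) (f : T -> U) (x0 : T)
    (g : 'rV[R]_n -> T) :
  continuous f -> spheroid x0 g -> spheroid (f x0) (f \o g).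
Proof.
by move=> cf [cg gx]; split=> [|t /gx /= ->//]; exact: within_comp.
Qed.

Lemma homotopic_rel_map n (T U : topologicalType) (f : T -> U) (x0 : T)
    (g h : 'rV[R]_n -> T) :
  continuous f -> homotopic_rel x0 g h -> homotopic_rel (f x0) (f \o g) (f \o h).
Proof.
move=> cf [H [cH H0 H1 Hb]]; exists (f \o H); split.
- exact: within_comp.
- by move=> t /H0 /= ->.
- by move=> t /H1 /= ->.
- by move=> s t su /(Hb s t su) /= ->.
Qed.

Lemma homotopic_rel_refl n (T : topologicalType) (x0 : T) (g : 'rV[R]_n -> T) :
  spheroid x0 g -> homotopic_rel x0 g g.
Proof.
move=> [cg gx]; exists (fun p => g p.2); split=> // [|s t _ /gx //].
apply/subspace_continuousP => -[s t] [_ /= ct].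
move/subspace_continuousP: cg => /(_ t ct) cg W /cg /= gW.
have snd_t : (fun p : R * 'rV[R]_n => p.2) @ (s, t) --> t by exact: cvg_snd.
have near_st : nbhs (s, t) [set p : R * 'rV[R]_n | cube p.2 -> W (g p.2)].
  exact: snd_t _ gW.
by apply: filterS near_st => -[s' t'] /= Wt [_ /Wt].
Qed.

Lemma homeomorphism_weak_equivalence (T U : topologicalType) (f : T -> U) :
  homeomorphism f -> weak_homotopy_equivalence R f.
Proof.
move=> [cf [g [cg fK gK]]]; split=> //.
- split=> [x y _ _ xy|y _].
    by rewrite -(fK x) -(fK y); exact: path_joined_map.
  by exists (g y); rewrite ?gK //; exact: path_joined_refl.
- move=> n x0 n0; split=> [a b _ _ ab|b sb].
    have := homotopic_rel_map cg ab; rewrite fK.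
    suff gf (u : 'rV[R]_n -> T) : g \o (f \o u) = u by rewrite !gf.
    by apply/funext => t; exact: fK.
  exists (g \o b); first by rewrite -(fK x0); exact: spheroid_map.
  have -> : f \o (g \o b) = b by apply/funext => t; exact: gK.
  exact: homotopic_rel_refl.
Qed.

End HomeomorphismWeakEquivalence.

Theorem theorem2p8 (R : realType) (X : complex R) (P : SD X -> Prop) (k : nat) :
  subdivisional_structure P -> convergent P ->
  (exists (C : topologicalType) (c : cocone (conf_diagram P k) C),
     is_colimit c) /\
  (forall (C : topologicalType) (c : cocone (conf_diagram P k) C)
     (hc : is_colimit c),
     homeomorphism (colim_map hc (conf_cocone P k)) /\
     weak_homotopy_equivalence R (colim_map hc (conf_cocone P k))).
Proof.
move=> sP cP; have colim := @conf_cocone_colimit R X P k sP cP.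
split; first by exists (Conf X k), (conf_cocone P k).
move=> C c hc; have hom := colimit_homeomorphism hc colim.
by split=> //; exact: homeomorphism_weak_equivalence.
Qed.
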